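(* Let $\Gamma$ and $\Gamma'$ be (rooted, locally finite) trees of height $2$. For each vertex in $\Gamma_1$, count its children and order the numbers so obtained in a decreasing sequence $n_1 \geq n_2 \geq \cdots \geq n_b$. Similarly obtain a sequence $n_1' \geq n_2' \geq \cdots \geq n_b'$ from $\Gamma'$, appending zeros to one of the sequences if necessary so that both have the same length $b$. Then $\Gamma$ dominates $\Gamma'$ if and only if $$\sum_{i > k} n_i \geq \sum_{i > k} n_i' \quad \text{for every } k \geq 0.$$
   Context: Trees are locally finite and rooted. For a tree $\Gamma$ with root $\rho$ and a vertex $v$, $|v|$ denotes the distance from the root to $v$; $\Gamma_n = \{v : |v| = n\}$ is the $n$-th generation, and $\Gamma_{|n}$ denotes the first $n$ levels of $\Gamma$, i.e. the subtree of vertices at distance at most $n$ from the root. A child of $v$ is a neighbor of $v$ farther from the root. The height is the largest $n$ with $\Gamma_n \neq \emptyset$. Given i.i.d. real random variables $\{X(v) : v \in \Gamma\}$ labelling the vertices, an integer $n \geq 1$ and a Borel set $B \subseteq \mathbb{R}^n$, $P(B; \Gamma_{|n})$ denotes the probability that there is a non-self-intersecting path $\rho, v_1, \ldots, v_n$ in $\Gamma$ starting at the root (so $|v_i| = i$) with $(X(v_1), \ldots, X(v_n)) \in B$. Domination: $\Gamma$ dominates $\Gamma'$ if whenever $\{X(v) : v \in \Gamma\} \cup \{X'(w) : w \in \Gamma'\}$ is a collection of i.i.d. random variables, $n \geq 1$ is an integer, and $B \subseteq \mathbb{R}^n$ is a Borel set, one has $P(B; \Gamma_{|n}) \geq P(B;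 \Gamma'_{|n})$, where the second probability is computed with the labels $X'$.
   Formalization: Added hypothesis: if some vertex of Γ'_1 has no children, then |Γ'_1| ≤ |Γ_1|; without it the claim fails at n = 1, e.g. for child counts (2) against (1,0), where the tail sums hold but Γ does not dominate Γ'. *)

(* Defs.v *)
From mathcomp Require Import all_boot all_order all_algebra finmap.
From mathcomp Require Import all_classical all_reals all_analysis.

Set Implicit Arguments.
Unset Strict Implicit.
Unset Printing Implicit Defensive.

Import Order.TTheory GRing.Theory Num.Theory.
Import numFieldNormedType.Exports.

Local Open Scope classical_set_scope.
Local Open Scope ring_scope.

(* Cycles of length at most 2 are degenerate ([:: x; y] only traverses an edge
   back and forth), hence the bound in [tree_acyclic]. *)
Record rooted_tree := RootedTree {
  vertex :> choiceType;
  adj : rel vertex;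
  root : vertex;
  adj_sym : symmetric adj;
  adj_irr : irreflexive adj;
  tree_connected : forall x y : vertex,
    exists p : seq vertex, path adj x p /\ last x p = y;
  tree_acyclic : forall c : seq vertex,
    (2 < size c)%N -> uniq c -> ~~ cycle adj c;
  locally_finite : forall v : vertex, finite_set [set w | adj v w] }.

Arguments adj {r}.
Arguments root : clear implicits.

Lemma ex_walk_from_root (G : rooted_tree) (v : G) : exists n,
  `[< exists p : seq G, [/\ path adj (root G) p, last (root G) p = v
                          & size p = n] >].
Proof.
by have [p [ep lp]] := tree_connected (root G) v; exists (size p); apply/asboolP; exists p.
Qed.

Definition depth (G : rooted_tree) (v : G) : nat :=
  ex_minn (ex_walk_from_root v).

Definition generation (G : rooted_tree) (n : nat) : set G :=
  [set v | depth v = n].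

Arguments generation : clear implicits.

Definition children (G : rooted_tree) (v : G) : set G :=
  [set w | adj v w /\ (depth v < depth w)%N].

Definition has_height (G : rooted_tree) (h : nat) : Prop :=
  generation G h !=set0 /\ forall n, (h < n)%N -> generation G n = set0.

(* [fset_set A] enumerates [A] when [A] is finite and is empty otherwise; the
   sets [children v] and [generation G 1] below are finite because [G] is
   locally finite. *)
Definition num_children (G : rooted_tree) (v : G) : nat :=
  size (fset_set (children v)).

Definition child_counts (G : rooted_tree) : seq nat :=
  sort geq [seq num_children v | v <- fset_set (generation G 1)].

Section Probability.
Context {R : realType} {d : measure_display} {T : measurableType d}.
Variable P : probability T R.

Definition mutually_independent (I : choiceType) (X : I -> {RV P >-> R}) :=
  forall (F : {fset I}) (A : I -> set R), (forall i, measurable (A i)) ->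
    P (\bigcap_(i in [set` F]) X i @^-1` A i) =
    (\prod_(i <- F) P (X i @^-1` A i))%E.

Definition identically_distributed (I : choiceType) (X : I -> {RV P >-> R}) :=
  forall i j (A : set R), measurable A ->
    distribution P (X i) A = distribution P (X j) A.

Definition iid (I : choiceType) (X : I -> {RV P >-> R}) :=
  mutually_independent X /\ identically_distributed X.

Definition path_event (G : rooted_tree) (X : G -> {RV P >-> R}) (n : nat)
    (B : set (n.-tuple R)) : set T :=
  [set t | exists p : n.-tuple G,
     [/\ path adj (root G) p, uniq (root G :: p) & B [tuple of [seq X v t | v <- p]]]].

Definition path_prob (G : rooted_tree) (X : G -> {RV P >-> R}) (n : nat)
    (B : set (n.-tuple R)) : \bar R := P (path_event X B).

End Probability.

(* The measurable subsets of [n.-tuple R] form the product of the Borel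
   sigma-algebras of the factors, that is, the Borel sigma-algebra of R^n. *)
Definition dominates (R : realType) (G G' : rooted_tree) : Prop :=
  forall (d : measure_display) (T : measurableType d) (P : probability T R)
    (X : G -> {RV P >-> R}) (X' : G' -> {RV P >-> R}),
    iid (fun i : G + G' => match i with inl v => X v | inr w => X' w end) ->
  forall (n : nat) (B : set (n.-tuple R)), (1 <= n)%N -> measurable B ->
    (path_prob X' B <= path_prob X B)%E.

(* Main.v *)
Require Import Defs.
From mathcomp Require Import all_boot all_order all_algebra finmap.
From mathcomp Require Import all_classical all_reals all_analysis measurable_realfun.
From mathcomp Require Import zify ring lra.

Set Implicit Arguments.
Unset Strict Implicit.
Unset Printing Implicit Defensive.

Import Order.TTheory GRing.Theory Num.Theory.
Import numFieldNormedType.Exports.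

Local Open Scope classical_set_scope.

(* Let mu be the common law of the labels, g x = mu {y | (x, y) \notin B} and
   a n = \int g^n d mu.  No path of length 2 has its labels in B with
   probability \prod_i a (n_i).  The sequence a is nonincreasing and log-convex,
   with a 0 = 1.  If the tail sums of (n_i) dominate those of (n'_i), the tangent
   lines of the convex sequence ln a at the n_i and an Abel summation give
   \prod_i a (n_i) <= \prod_i a (n'_i).

   Conversely, take labels uniform on [0, 1] and B = [q^m, 1] x [q, 1].  Then g
   is 1 on [0, q^m) and q elsewhere, so a n lies between q^(min n m) and
   2 q^(min n m).  As q tends to 0, domination forces
   \sum_i min n'_i m <= \sum_i min n_i m for every m; the tail inequality over
   i > k follows from the choice m = n'_(k+1). *)

(** * Log-convex sequences and tail sums *)

Section RealSequences.
Context {R : realType}.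
Local Open Scope ring_scope.

(** Summation by parts, one term at a time: the tail of [d] from index 1 is nonnegative, so raising
    its weight from [w 0] to [w 1] can only increase the sum. *)
Lemma abel_sum_ge (n : nat) (w d : nat -> R) :
    (forall i, (i < n)%N -> w i <= w i.+1) ->
    (forall k, 0 <= \sum_(k <= i < n.+1) d i) ->
  w 0 * \sum_(0 <= i < n.+1) d i <= \sum_(0 <= i < n.+1) w i * d i.
Proof.
elim: n w d => [|n IHn] w d wi d0; first by rewrite !big_nat1.
rewrite big_nat_recl// [leRHS]big_nat_recl// mulrDr lerD2l.
apply: le_trans (IHn (w \o S) (d \o S) _ _) => /=.
- by rewrite ler_wpM2r ?wi// -(big_add1 _ _ 0 n.+2 xpredT) d0.
- by move=> i ni; exact: wi.
- by move=> k; rewrite -(big_add1 _ _ k n.+2 xpredT) d0.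
Qed.

Lemma abel_sum_ge0 (n : nat) (w d : nat -> R) :
    (forall i, 0 <= w i) -> (forall i, (i.+1 < n)%N -> w i <= w i.+1) ->
    (forall k, 0 <= \sum_(k <= i < n) d i) ->
  0 <= \sum_(0 <= i < n) w i * d i.
Proof.
case: n => [|n] w0 wi d0; first by rewrite big_nil.
by apply: le_trans (abel_sum_ge _ d0) => //; rewrite mulr_ge0.
Qed.

Lemma convex_slope_homo (f : nat -> R) :
    (forall n, f n.+1 - f n <= f n.+2 - f n.+1) ->
  {homo (fun n => f n.+1 - f n) : i j / (i <= j)%N >-> i <= j}.
Proof.
move=> cf i; elim=> [|j IH]; first by rewrite leqn0 => /eqP ->.
by rewrite leq_eqVlt => /predU1P[->//|/IH /le_trans]; apply.
Qed.

(** Steps to the right of [n] have slope at least [f n.+1 - f n], steps to its left at most that. *)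
Lemma convex_subgradient (f : nat -> R) :
    (forall n, f n.+1 - f n <= f n.+2 - f n.+1) ->
  forall n m, (f n.+1 - f n) * (m%:R - n%:R) <= f m - f n.
Proof.
move=> /convex_slope_homo sl n m; case: (leqP n m) => [/subnKC <-|/ltnW /subnKC <-].
- elim: (m - n)%N => [|k IH]; first by rewrite addn0 !subrr mulr0.
  have /= := sl _ _ (leq_addr k n); move: IH.
  by rewrite addnS -(addn1 (n + k)) !natrD addn1; lra.
- elim: (n - m)%N => [|k IH]; first by rewrite addn0 !subrr mulr0.
  (* The base point [m + k] moves with the induction, so the slope comparison is scaled by the whole
     distance [k.+1]. *)
  have /= := ler_wpM2l (ler0n R k.+1) (sl _ _ (leqnSn (m + k))); move: IH.
  rewrite addnS -[(m + k).+1 in X in _ -> _ -> _ * (_ - X) <= _]addn1.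
  by rewrite -(addn1 k) !natrD; lra.
Qed.

Lemma prod_log_convex_le (a : nat -> R) (b : nat) (x y : nat -> nat) :
    (forall n, 0 < a n) -> (forall n, a n.+1 <= a n) ->
    (forall n, a n.+1 ^+ 2 <= a n * a n.+2) ->
    (forall i, (x i.+1 <= x i)%N) ->
    (forall k, \sum_(k <= i < b) y i <= \sum_(k <= i < b) x i)%N ->
  \prod_(0 <= i < b) a (x i) <= \prod_(0 <= i < b) a (y i).
Proof.
move=> a0 na ca nx yx.
pose f n := ln (a n).
have nf n : f n.+1 <= f n by rewrite ler_ln ?posrE.
have cf n : f n.+1 - f n <= f n.+2 - f n.+1.
  suff : f n.+1 + f n.+1 <= f n + f n.+2 by lra.
  by rewrite -!lnM ?posrE// ler_ln ?posrE ?mulr_gt0// -expr2.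
have lnp z : ln (\prod_(0 <= i < b) a (z i)) = \sum_(0 <= i < b) f (z i).
  elim: b {yx} => [|n IH]; first by rewrite !big_nil ln1.
  by rewrite !big_nat_recr//= lnM ?IH ?posrE// prodr_gt0.
rewrite -ler_ln ?posrE ?prodr_gt0// !lnp -subr_ge0 -sumrB.
(* [w i] is minus the slope of the tangent at [x i]: nonnegative because [f] is nonincreasing, and
   nondecreasing in [i] because [x] is nonincreasing and [f] is convex. *)
pose w i := f (x i) - f (x i).+1.
apply: (@le_trans _ _ (\sum_(0 <= i < b) w i * ((x i)%:R - (y i)%:R))).
  apply: abel_sum_ge0 => [i|i _|k].
  - by rewrite /w subr_ge0.
  - by have /= := convex_slope_homo cf (nx i); rewrite /w; lra.
  - by rewrite sumrB subr_ge0 -!natr_sum ler_nat.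
apply: ler_sum => i _.
by have := convex_subgradient cf (x i) (y i); rewrite /w; lra.
Qed.

End RealSequences.

(* The inequality at [k] follows from the one with [m = y k]. *)
Lemma leq_tail_sum (b : nat) (x y : nat -> nat) :
    {homo y : i j / (i <= j)%N >-> (j <= i)%N} ->
    (forall m, (0 < m)%N ->
      \sum_(0 <= i < b) minn (y i) m <= \sum_(0 <= i < b) minn (x i) m)%N ->
  forall k, (\sum_(k <= i < b) y i <= \sum_(k <= i < b) x i)%N.
Proof.
move=> ny yx k.
case: (leqP b k) => [bk|/ltnW kb]; first by rewrite !big_geq.
have [yk0|yk0] := posnP (y k).
  rewrite big_nat big1// => i /andP[ki _].
  by apply/eqP; rewrite -leqn0 -yk0 ny.
(* Truncated at [y k], the first [k] terms for [y] all equal [y k], while those for [x] are at most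
   [y k]; only the tails remain to be compared. *)
have := yx _ yk0; rewrite (@big_cat_nat _ _ _ k)//=.
rewrite [X in (_ <= X)%N -> _](@big_cat_nat _ _ _ k)//=.
rewrite [X in (X + _ <= _)%N](_ : _ = \sum_(0 <= i < k) y k)%N; last first.
  by apply: eq_big_nat => i /andP[_ /ltnW ik]; apply/minn_idPr/ny.
rewrite [X in (_ + X <= _)%N](_ : _ = \sum_(k <= i < b) y i)%N; last first.
  by apply: eq_big_nat => i /andP[ki _]; apply/minn_idPl/ny.
have le1 : (\sum_(0 <= i < k) minn (x i) (y k) <= \sum_(0 <= i < k) y k)%N.
  by apply: leq_sum => i _; rewrite geq_minr.
have le2 : (\sum_(k <= i < b) minn (x i) (y k) <= \sum_(k <= i < b) x i)%N.
  by apply: leq_sum => i _; rewrite geq_minl.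
by move: le1 le2; lia.
Qed.

(** Replaces the limit of a ratio of powers: if [S < S'], the single value [M = c + 1] already gives
    a contradiction, since [c / (c + 1) < 1]. *)
Lemma leq_exponent_of_bounded {R : realType} (c S S' : nat) : 
  (forall M : nat, (0 < M)%N -> 
    (M%:R^-1 ^+ S : R) <= c%:R * M%:R^-1 ^+ S')%R -> (S' <= S)%N.
Proof.
move=> h; rewrite leqNgt; apply/negP => SS'.
have := h c.+1 isT; apply/negP; rewrite -ltNge.
rewrite -(subnKC SS') exprD exprS mulrA mulrA.
have c0 : (0 < c.+1%:R :> R)%R by rewrite ltr0n.
have i0 : (0 < c.+1%:R^-1 :> R)%R by rewrite invr_gt0.
have i1 : (c.+1%:R^-1 <= 1 :> R)%R by rewrite invf_le1// ler1n.
apply: (@le_lt_trans _ _ (c%:R * c.+1%:R^-1 * c.+1%:R^-1 ^+ S)%R).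
  by rewrite ler_piMr ?mulr_ge0 ?exprn_ge0 ?exprn_ile1// ltW.
by rewrite gtr_pMl ?exprn_gt0// ltr_pdivrMr// mul1r ltr_nat.
Qed.

(** * Trees of height two *)

Section RootedTrees.
Variable G : rooted_tree.
Implicit Types (u v w x : G) (p : seq G).
Local Notation o := (Defs.root G).

Lemma depth_le p : path adj o p -> depth (last o p) <= size p.
Proof.
move=> op; rewrite /depth; case: ex_minnP => m _; apply.
by apply/asboolP; exists p.
Qed.

Lemma depth_path v : exists p, [/\ path adj o p, last o p = v & size p = depth v].
Proof. by rewrite /depth; case: ex_minnP => m /asboolP. Qed.

Lemma depth_root : depth o = 0.
Proof. by apply/eqP; rewrite -leqn0 (@depth_le [::]). Qed.

Lemma depth_eq0 v : (depth v == 0) = (v == o).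
Proof.
apply/eqP/eqP => [|->]; last exact: depth_root.
by have [p [_ <- <-]] := depth_path v => /size0nil ->.
Qed.

Lemma depth_adj v w : adj v w -> depth w <= (depth v).+1.
Proof.
move=> vw; have [p [op pv <-]] := depth_path v.
rewrite -(size_rcons p w) -[in leqLHS](last_rcons o p w) depth_le//.
by rewrite rcons_path op pv.
Qed.

(** The parent is the last vertex but one on a shortest path from the root. *)
Lemma depth_parent n w : depth w = n.+1 -> exists2 u, adj u w & depth u = n.
Proof.
move=> wn.
have [p [+ + sw]] := depth_path w; rewrite wn in sw; case/lastP: p sw => // p x.
rewrite size_rcons last_rcons rcons_path => -[pn] /andP[op px] xw.
exists (last o p); rewrite -?xw//; apply/eqP; rewrite eqn_leq -{1}pn depth_le//=.
by rewrite -ltnS -wn -xw depth_adj.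
Qed.

Lemma generation1E : generation G 1 = [set v | adj o v].
Proof.
apply/seteqP; split=> v /= => [/depth_parent[u uv /eqP]|ov].
  by rewrite depth_eq0 => /eqP <-.
apply/eqP; rewrite eqn_leq lt0n depth_eq0 -[X in _ <= X.+1]depth_root depth_adj//=.
by apply: contraTneq ov => ->; rewrite adj_irr.
Qed.

Lemma finite_generation1 : finite_set (generation G 1).
Proof. by rewrite generation1E; exact: locally_finite. Qed.

Lemma finite_children v : finite_set (children v).
Proof. by apply: sub_finite_set (locally_finite v) => w []. Qed.

Lemma mem_generation1 v : (v \in fset_set (generation G 1)) = adj o v.
Proof.
rewrite in_fset_set; last exact: finite_generation1.
by rewrite generation1E; apply/idP/idP; rewrite inE.
Qed.

Lemma mem_children v w :
  (w \in fset_set (children v)) = adj v w && (depth v < depth w).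
Proof.
rewrite in_fset_set; last exact: finite_children.
by apply/idP/andP; rewrite inE.
Qed.

Lemma depth1 v : adj o v -> depth v = 1.
Proof. by move=> ov; have : generation G 1 v by rewrite generation1E. Qed.

(** Edges from the first to the second generation, kept as a list of pairs (parent, child) so that
    probabilities can be computed by induction on it. *)
Definition child_edges : seq (G * G) :=
  [seq (v, w) | v <- fset_set (generation G 1), w <- fset_set (children v)].

Lemma mem_child_edges v w :
  ((v, w) \in child_edges) = [&& adj o v, adj v w & depth w == 2].
Proof.
apply/allpairsPdep/and3P => [[x [y [+ + [-> ->]]]]|[ov vw /eqP w2]].
  rewrite mem_generation1 mem_children => ox /andP[xy]; rewrite (depth1 ox) => y2.
  by split => //; rewrite eqn_leq y2 andbT -(depth1 ox) depth_adj.
by exists v, w; rewrite mem_generation1 mem_children ov vw w2 (depth1 ov).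
Qed.

Lemma acyclic (c : seq G) : 2 < size c -> uniq c -> cycle adj c -> False.
Proof. by move=> c2 /(tree_acyclic c2)/negP. Qed.

Lemma adj_neq v w : adj v w -> v != w.
Proof. by apply: contraTneq => ->; rewrite adj_irr. Qed.

(** Two distinct parents of [w] would close a cycle of length 4 through the root. *)
Lemma parent_inj u v w : adj o u -> adj o v -> adj u w -> adj v w ->
  depth w = 2 -> u = v.
Proof.
move=> ou ov uw vw w2; apply/eqP/negPn/negP => uv.
have now : o != w by apply: contra_eq_neq w2 => <-; rewrite depth_root.
case: (@acyclic [:: o; u; w; v] isT) => /=.
- rewrite !inE !negb_or (adj_neq ou) now (adj_neq ov) (adj_neq uw) uv.
  by rewrite adj_neq// adj_sym.
- by rewrite ou uw adj_sym vw adj_sym ov.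
Qed.

(** Each label of the second generation thus enters a single edge constraint, which is where
    independence comes from. *)
Lemma uniq_child_edges : uniq (unzip2 child_edges).
Proof.
rewrite map_inj_in_uniq.
  apply: allpairs_uniq_dep => [|v _|[v w] [v' w'] _ _ /= [-> ->]//].
  - exact: fset_uniq.
  - exact: fset_uniq.
move=> [v w] [v' w']; rewrite !mem_child_edges /=.
move=> /and3P[ov vw /eqP w2] /and3P[ov' vw' _] ww'; rewrite -{w'}ww' in vw' *.
by rewrite (parent_inj ov ov' vw vw').
Qed.

(** Turns the exponents produced by [probability_edge_event] into child counts. *)
Lemma count_child_edges v : adj o v ->
  count (fun e => e.1 == v) child_edges = num_children v.
Proof.
rewrite -mem_generation1 /child_edges /num_children => vG.
rewrite count_flatten -map_comp.
rewrite (@eq_map _ _ _ (fun x => (x == v) * num_children x)); last first.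
  move=> x /=; rewrite count_map /= -/(num_children x).
  by rewrite (@eq_count _ _ (fun=> x == v))//; case: eqP => _;
    rewrite ?count_predT ?count_pred0 ?mul1n.
rewrite sumnE big_map (bigD1_seq v)//= eqxx mul1n big1 ?addn0// => x.
by move=> /negbTE ->.
Qed.

End RootedTrees.

(** * Self-avoiding paths in trees of height two *)

Section HeightTwo.
Variable G : rooted_tree.
Implicit Types (u v w x : G) (p : seq G).
Local Notation o := (Defs.root G).
Hypothesis hG : has_height G 2.

Lemma depth_le2 v : depth v <= 2.
Proof.
rewrite leqNgt; apply/negP => /(hG.2 _) v2.
by have : generation G (depth v) v by []; rewrite v2.
Qed.

(** If [w] had depth 1, then [o], [v], [w] would form a triangle. *)
Lemma depth_adj2 v w : adj o v -> adj v w -> w != o -> depth w = 2.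
Proof.
move=> ov vw wo; apply/eqP; rewrite eqn_leq depth_le2/= ltn_neqAle lt0n.
rewrite depth_eq0 wo andbT eq_sym; apply/negP => /eqP w1.
have ow : adj o w by have : generation G 1 w by []; rewrite generation1E.
case: (@acyclic _ [:: o; v; w] isT) => /=.
- by rewrite !inE negb_or (adj_neq ov) (adj_neq ow) (adj_neq vw).
- by rewrite ov vw adj_sym ow.
Qed.

Lemma mem_child_edges2 v w :
  ((v, w) \in child_edges G) = [&& adj o v, adj v w & w != o].
Proof.
rewrite mem_child_edges; case: (boolP (adj o v)) => //= ov.
case: (boolP (adj v w)) => //= vw; apply/eqP/idP => [w2|]; last exact: (depth_adj2 ov vw).
by apply: contra_eq_neq w2 => ->; rewrite depth_root.
Qed.

(** Paths are only required to be self-avoiding, so a third vertex [x] could a priori go back up or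
    sideways. At depth 1 it would be a second parent of [w]; at depth 2 its parent closes a cycle of
    length 3 or 5. *)
Lemma simple_path_le2 p : path adj o p -> uniq (o :: p) -> size p <= 2.
Proof.
case: p => [|v [|w [|x p]]]//; move=> /= /and4P[ov vw wx _].
rewrite !inE !negb_or => /and4P[/and4P[nov now nox _] /and3P[nvw nvx _] /andP[nwx _] _].
have w2 : depth w = 2 by apply: (depth_adj2 ov vw); rewrite eq_sym.
have : depth x != 0 by rewrite depth_eq0 eq_sym.
have := depth_le2 x; case x2 : (depth x) => [|[|[|//]]]// _ _.
- have ox : adj o x by have : generation G 1 x by []; rewrite generation1E.
  by move: nvx; rewrite (parent_inj ov ox vw _ w2) ?eqxx// adj_sym.
- have [u ux /[dup] u1 uG1] := depth_parent x2.
  have ou : adj o u by have : generation G 1 u by []; rewrite generation1E.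
  have nwu : w != u by apply: contra_eq_neq w2 => ->; rewrite u1.
  have nxu : x != u by rewrite eq_sym adj_neq.
  have [vu|nvu] := eqVneq v u.
    case: (@acyclic _ [:: v; w; x] isT) => /=.
    + by rewrite !inE negb_or nvw nvx nwx.
    + by rewrite vw wx adj_sym vu ux.
  case: (@acyclic _ [:: o; v; w; x; u] isT) => /=.
  + by rewrite !inE !negb_or nvw nvx nwx nov now nox (adj_neq ou) nvu nwu nxu.
  + by rewrite ov vw wx adj_sym ux adj_sym ou.
Qed.

End HeightTwo.

(** * The probability of avoiding B *)

Section SectionProbability.
Context {R : realType}.
Local Open Scope ring_scope.
Local Open Scope ereal_scope.

(** The hypothesis says that on [H] the pair ([Y], [Z]) has a product law, because rectangles
    determine a finite measure; the formula is then Fubini over the second coordinate. *)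
Lemma independent_section {d} {T : measurableType d} (P : probability T R)
    (H : set T) (Y Z : {RV P >-> R}) (mu : probability R R) (D : set (R * R)) :
    measurable H -> measurable D ->
    (forall A C : set R, measurable A -> measurable C ->
      P (H `&` (Y @^-1` A `&` Z @^-1` C)) = P (H `&` Y @^-1` A) * mu C) ->
  P (H `&` [set t | D (Y t, Z t)]) =
  \int[mu]_y P (H `&` Y @^-1` ysection D y).
Proof.
move=> mH mD HYZ.
have mY : measurable_fun setT Y by exact: measurable_funPT.
have mYZ : measurable_fun setT (fun t => (Y t, Z t) : R * R).
  exact: measurable_fun_pair.
pose nuY : {measure set R -> \bar R} :=
  measure_function_pushforward__canonical__measure_function_Measure
    (mrestr P mH) mY.
have nuY_fin : nuY setT < +oo.
  rewrite /nuY /= /pushforward /mrestr preimage_setT setTI.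
  by rewrite -ge0_fin_numE ?fin_num_measure.
(* Restriction to the whole line only serves to package the pushforward as a finite measure. *)
pose nu : {finite_measure set R -> \bar R} := mfrestr measurableT nuY_fin.
have nuE A : nu A = P (H `&` Y @^-1` A).
  by rewrite /nu/= /mfrestr /mrestr /= /pushforward setIT /mrestr setIC.
pose k : {measure set (R * R) -> \bar R} :=
  measure_function_pushforward__canonical__measure_function_Measure
    (mrestr P mH) mYZ.
have kE E : k E = P (H `&` [set t | E (Y t, Z t)]).
  by rewrite /k /= /pushforward /mrestr setIC.
rewrite -kE -(@product_measure_unique _ _ _ _ _ nu mu k)//; last first.
  move=> A C mA mC; apply: (etrans (kE _)).
  by rewrite [LHS]HYZ//; congr (_ * _); exact: esym (nuE A).
(* Passing to the product that integrates over the second factor makes the [ysection] appear. *)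
rewrite (@product_measure_unique _ _ _ _ _ nu mu (nu \x^ mu))//; last first.
  by move=> A C mA mC; exact: product_measure2E.
by apply: eq_integral => y _; exact: nuE.
Qed.


(** The function [g] of the introduction, with [D] the complement of B. It is made real-valued so
    that its powers are taken in [R]. *)
Definition section_prob (mu : probability R R) (D : set (R * R)) (x : R) : R :=
  fine (mu (xsection D x)).

(** * Moments of the section probability *)

Section Moments.
Variables (mu : probability R R) (D : set (R * R)).
Hypothesis mD : measurable D.
Local Notation g := (section_prob mu D).

Lemma section_probE x : (g x)%:E = mu (xsection D x).
Proof. by rewrite fineK// fin_num_measure//; exact: measurable_xsection. Qed.

Lemma section_prob_ge0 x : (0 <= g x)%R.
Proof. exact: fine_ge0. Qed.

Lemma section_prob_le1 x : (g x <= 1)%R.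
Proof.
by rewrite -lee_fin section_probE probability_le1//; exact: measurable_xsection.
Qed.

Lemma measurable_section_prob : measurable_fun setT g.
Proof.
apply/measurable_EFinP; rewrite (_ : _ \o _ = mu \o xsection D).
  exact: measurable_fun_xsection.
by apply/funext => x /=; exact: section_probE.
Qed.

Lemma measurable_section_probX n : measurable_fun setT (fun x => g x ^+ n)%R.
Proof. by apply: measurable_funX; exact: measurable_section_prob. Qed.

Lemma section_probX_ge0 n x : (0 <= g x ^+ n)%R.
Proof. by rewrite exprn_ge0// section_prob_ge0. Qed.

Lemma section_probX_le1 n x : (g x ^+ n <= 1)%R.
Proof. by rewrite exprn_ile1 ?section_prob_ge0 ?section_prob_le1. Qed.

(** By Tonelli, integrating the indicator of [D] over [y] first yields one more factor [g x]: each
    additional child raises the exponent by one. *)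
Lemma integral_ysection_moment (A : set R) (k : \bar R) n : measurable A -> 0 <= k ->
  \int[mu]_y (k * \int[mu]_(x in A `&` ysection D y) (g x ^+ n)%:E) =
  k * \int[mu]_(x in A) (g x ^+ n.+1)%:E.
Proof.
move=> mA k0.
pose f (z : R * R) := (\1_A z.1 * \1_D z * g z.1 ^+ n)%:E.
have f0 z : 0 <= f z by rewrite lee_fin !mulr_ge0// section_probX_ge0.
have mf : measurable_fun setT f.
  apply/measurable_EFinP; apply: measurable_funM; first apply: measurable_funM.
  - exact: (measurableT_comp (measurable_indic mA) measurable_fst).
  - exact: measurable_indic.
  - exact: (measurableT_comp (measurable_section_probX n) measurable_fst).
have fG y : \int[mu]_(x in A `&` ysection D y) (g x ^+ n)%:E = fubini_G mu f y.
  rewrite integral_mkcond; apply: eq_integral => x _.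
  rewrite patchE /f /= !indicE in_setI mem_ysection.
  by case: (x \in A); case: ((x, y) \in D); rewrite /= ?(mul0r, mul1r).
under eq_integral do rewrite fG.
rewrite ge0_integralZl//; last 2 first.
  - exact: measurable_fun_fubini_tonelli_G.
  - by move=> y _; exact: integral_ge0.
congr (_ * _); rewrite -fubini_tonelli2// fubini_tonelli1// [RHS]integral_mkcond.
apply: eq_integral => x _; rewrite patchE /fubini_F /f /=.
under eq_integral do rewrite mulrAC EFinM.
rewrite ge0_integralZl//; last 2 first.
  - apply/measurable_EFinP; rewrite (_ : (fun y => _) = \1_(xsection D x)).
      by apply: measurable_indic; exact: measurable_xsection.
    by apply/funext => y; rewrite !indicE mem_xsection.
  - by rewrite lee_fin mulr_ge0// section_probX_ge0.
rewrite (_ : \int[mu]_y (\1_D (x, y))%:E = (g x)%:E).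
  rewrite -EFinM indicE exprSr.
  by case: (x \in A); rewrite /= ?mul1r ?mul0r.
rewrite section_probE; under eq_integral => y _.
  rewrite (_ : \1_D (x, y) = \1_(xsection D x) y); first over.
  by rewrite !indicE mem_xsection.
by rewrite integral_indic ?setIT//; exact: measurable_xsection.
Qed.
Lemma measurable_EFin_section_probX n :
  measurable_fun setT (fun x => (g x ^+ n)%:E).
Proof. by apply/measurable_EFinP; exact: measurable_section_probX. Qed.

(** The sequence [a] of the introduction; the integral is finite because [g] lies between 0 and
    1. *)
Definition section_moment n : R := fine (\int[mu]_x (g x ^+ n)%:E).

Lemma integral_section_probX_ge0 n : 0 <= \int[mu]_x (g x ^+ n)%:E.
Proof. by apply: integral_ge0 => x _; rewrite lee_fin section_probX_ge0. Qed.

Lemma section_momentE n : (section_moment n)%:E = \int[mu]_x (g x ^+ n)%:E.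
Proof.
rewrite fineK// ge0_fin_numE ?integral_section_probX_ge0//.
apply: (@le_lt_trans _ _ (\int[mu]_x (cst 1%:E x))).
  apply: ge0_le_integral => //= [x _| |x _].
  - by rewrite lee_fin section_probX_ge0.
  - exact: measurable_EFin_section_probX.
  - by rewrite lee_fin section_probX_le1.
by rewrite integral_cst// [X in _ * X]probability_setT mule1 ltry.
Qed.

Lemma section_moment_ge0 n : (0 <= section_moment n)%R.
Proof. by rewrite fine_ge0// integral_section_probX_ge0. Qed.

Lemma section_moment0 : section_moment 0 = 1%R.
Proof.
rewrite /section_moment; under eq_integral do rewrite expr0.
by rewrite integral_cst// [X in _ * X]probability_setT mule1.
Qed.

Lemma section_momentS_le n : (section_moment n.+1 <= section_moment n)%R.
Proof.
rewrite -lee_fin !section_momentE; apply: ge0_le_integral => //= [x _| | |x _].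
- by rewrite lee_fin section_probX_ge0.
- exact: measurable_EFin_section_probX.
- exact: measurable_EFin_section_probX.
- by rewrite lee_fin exprS ler_piMl ?section_probX_ge0 ?section_prob_le1.
Qed.

(* The integral of [g ^+ n * (g - c) ^+ 2] is nonnegative, and the best choice
   of [c] is the ratio of the moments of order [n.+1] and [n]. *)
Lemma section_moment_log_convex n :
  (section_moment n.+1 ^+ 2 <= section_moment n * section_moment n.+2)%R.
Proof.
have quad c : (0 <= c -> 2 * c * section_moment n.+1 <=
    section_moment n.+2 + c ^+ 2 * section_moment n)%R.
  move=> c0; rewrite -lee_fin EFinD (EFinM (2 * c)) (EFinM (c ^+ 2)) !section_momentE.
  have mp n' := measurable_EFin_section_probX n'.
  have ge0 n' x : setT x -> 0 <= (g x ^+ n')%:E.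
    by move=> _; rewrite lee_fin section_probX_ge0.
  have c20 : 0 <= (c ^+ 2)%:E by rewrite lee_fin exprn_ge0.
  rewrite -(ge0_integralZl _ measurableT (mp n.+1) (ge0 n.+1)) ?lee_fin ?mulr_ge0//.
  rewrite -(ge0_integralZl _ measurableT (mp n) (ge0 n))//.
  rewrite -ge0_integralD//; last 3 first.
  - exact: ge0.
  - by move=> x /ge0 xn; exact: mule_ge0.
  - exact: measurable_funeM.
  apply: ge0_le_integral => //= [x _| | |x _].
  - by rewrite -EFinM lee_fin !mulr_ge0// section_probX_ge0.
  - apply: measurable_funeM; exact: measurable_EFin_section_probX.
  - apply: emeasurable_funD; first exact: measurable_EFin_section_probX.
    apply: measurable_funeM; exact: measurable_EFin_section_probX.
  rewrite -!EFinM -EFinD lee_fin -subr_ge0.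
  rewrite (_ : _ - _ = g x ^+ n * (g x - c) ^+ 2)%R; last by rewrite !exprS; ring.
  by rewrite mulr_ge0 ?section_probX_ge0// sqr_ge0.
(* The ratio needs a nonzero denominator; if the moment of order [n] vanishes, monotonicity kills
   the next one as well. *)
have [m0|m0] := eqVneq (section_moment n) 0%R.
  suff -> : section_moment n.+1 = 0%R by rewrite m0 mul0r expr0n.
  by apply/eqP; rewrite eq_le section_moment_ge0 andbT -[leRHS]m0 section_momentS_le.
have {}m0 : (0 < section_moment n)%R by rewrite lt_def m0 section_moment_ge0.
have := quad (section_moment n.+1 / section_moment n)%R.
rewrite divr_ge0 ?section_moment_ge0// => /(_ isT).
rewrite -(ler_pM2l m0); set a := section_moment n; set b := section_moment n.+1.
rewrite (_ : a * (2 * (b / a) * b) = 2 * b ^+ 2)%R; last by field; rewrite gt_eqF.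
rewrite (_ : a * (_ + _) = a * section_moment n.+2 + b ^+ 2)%R; last first.
  by field; rewrite gt_eqF.
by lra.
Qed.

(** Here [g ^+ n] equals [q ^+ n + (1 - q ^+ n) * \1_A], which integrates termwise. *)
Lemma section_moment_two_valued (A : set R) (p q : R) n :
    measurable A -> mu A = p%:E -> (0 <= q <= 1)%R ->
    (forall x, A x -> g x = 1%R) -> (forall x, ~ A x -> g x = q) ->
  section_moment n = (q ^+ n + (1 - q ^+ n) * p)%R.
Proof.
move=> mA Ap /andP[q0 q1] gA gNA; apply: EFin_inj; rewrite section_momentE.
have qn0 : (0 <= q ^+ n)%R by rewrite exprn_ge0.
have qn1 : (0 <= 1 - q ^+ n)%R by rewrite subr_ge0 exprn_ile1.
transitivity (\int[mu]_x ((q ^+ n)%:E + (1 - q ^+ n)%:E * (\1_A x)%:E)).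
  apply: eq_integral => x _; rewrite -EFinM -EFinD indicE; congr EFin.
  have [/set_mem xA|/negP xA] := boolP (x \in A); first by rewrite gA// expr1n /=; ring.
  by rewrite gNA /= ?mulr0 ?addr0// => Ax; apply: xA; rewrite inE.
have mI : measurable_fun setT (EFin \o \1_A : R -> \bar R).
  by apply/measurable_EFinP; exact: measurable_indic.
rewrite ge0_integralD//; last 2 first.
- by move=> x _; rewrite -EFinM lee_fin mulr_ge0.
- exact: measurable_funeM.
rewrite integral_cst// ge0_integralZl// integral_indic// setIT.
by rewrite [X in _ * X + _]probability_setT mule1 [in RHS]EFinD [in RHS]EFinM -Ap.
Qed.

End Moments.

(** * Edge constraints on independent labels *)

Section EdgeIndependence.
Context {d} {T : measurableType d} (P : probability T R).
Variables (I : choiceType) (X : I -> {RV P >-> R}).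
Variables (mu : probability R R) (D : set (R * R)).
Hypothesis mD : measurable D.
Hypothesis indepX : mutually_independent X.
Hypothesis lawX : forall i A, measurable A -> P (X i @^-1` A) = mu A.

(** The sets [A i] leave room for the induction, where the end of a removed edge becomes a vertex
    with a constraint of its own; they also express paths of length 1. *)
Definition edge_event (s : seq I) (es : seq (I * I)) (A : I -> set R) : set T :=
  [set t | (forall i, i \in s -> A i (X i t)) /\
           (forall e, e \in es -> D (X e.1 t, X e.2 t))].

Lemma measurable_preimageT d' (T' : measurableType d') (f : T -> T') (A : set T') :
  measurable_fun setT f -> measurable A -> measurable (f @^-1` A).
Proof. by move=> mf mA; rewrite -[_ @^-1` _]setTI; exact: mf. Qed.

Lemma measurable_forall_seq (J : choiceType) (s : seq J) (F : J -> set T) :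
  (forall i, measurable (F i)) -> measurable [set t | forall i, i \in s -> F i t].
Proof.
move=> mF; rewrite (_ : [set t | _] = \big[setI/setT]_(i <- s) F i).
  exact: bigsetI_measurable.
by rewrite -bigcap_seq.
Qed.

Lemma measurable_edge_event s es A : (forall i, measurable (A i)) ->
  measurable (edge_event s es A).
Proof.
move=> mA; apply: measurableI.
  apply: (@measurable_forall_seq _ s (fun i => X i @^-1` A i)) => i.
  exact: measurable_preimageT (measurable_funPT _) (mA i).
apply: (@measurable_forall_seq _ es
  (fun e => (fun t => (X e.1 t, X e.2 t)) @^-1` D)) => e.
apply: measurable_preimageT mD; exact: measurable_fun_pair.
Qed.

(* Induction on the edges: for an edge (v, w), the induction hypothesis applied
   to [w :: s] says that, on the event given by the other edges, the law of
   (X v, X w) is a product measure, so that [independent_section] applies. *)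
Lemma probability_edge_event (es : seq (I * I)) (s : seq I) (A : I -> set R) :
    (forall i, measurable (A i)) -> uniq s -> uniq (unzip2 es) ->
    {subset unzip1 es <= s} -> {in unzip2 es, forall w, w \notin s} ->
  P (edge_event s es A) =
  \prod_(i <- s) \int[mu]_(x in A i)
    (section_prob mu D x ^+ count (fun e => e.1 == i) es)%:E.
Proof.
elim: es s A => [|[v w] es IH] s A mA us /=.
  move=> _ _ _; rewrite (_ : edge_event _ _ _ =
      \bigcap_(i in [set` [fset i in s]%fset]) X i @^-1` A i); last first.
    apply/seteqP; split=> t /=.
      by move=> [h _] i /=; rewrite in_fset/=; exact: h.
    by move=> h; split => // i si; apply: (h i); rewrite /= in_fset.
  rewrite indepX// (perm_big s)/=; last first.
    by apply: uniq_perm => // i; rewrite in_fset.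
  apply: eq_bigr => i _; rewrite lawX//.
  under eq_integral do rewrite expr0.
  by rewrite integral_cst// mul1e.
move=> /andP[wes ues] sub1 sub2.
have vs : v \in s by apply: sub1; rewrite inE eqxx.
have ws : w \notin s by apply: sub2; rewrite inE eqxx.
have vw : v != w by apply: contraNneq ws => <-.
have sub1' : {subset unzip1 es <= s} by move=> i ies; apply: sub1; rewrite inE ies orbT.
have sub2' : {in unzip2 es, forall w', w' \notin s}.
  by move=> i ies; apply: sub2; rewrite inE ies orbT.
pose c := count (fun e => e.1 == v) es.
pose K := \prod_(i <- rem v s) \int[mu]_(x in A i)
  (section_prob mu D x ^+ count (fun e => e.1 == i) es)%:E.
have K0 : 0 <= K.
  rewrite /K; apply: (big_ind (fun x => 0 <= x)) => // [x y|i _]; first exact: mule_ge0.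
  by apply: integral_ge0 => x _; rewrite lee_fin section_probX_ge0.
(* [H] omits the constraint [A v], so that the label of [v] can be tested against an arbitrary set
   [B]; [D1] restores it below. *)
pose H := edge_event (rem v s) es A.
have mH : measurable H by exact: measurable_edge_event.
have HE B C : measurable B -> measurable C ->
    P (H `&` (X v @^-1` B `&` X w @^-1` C)) =
    K * \int[mu]_(x in B) (section_prob mu D x ^+ c)%:E * mu C.
  move=> mB mC.
  (* With [C] prescribed at [w] and [B] at [v], the rectangle event becomes an edge event for
     [w :: s]. *)
  pose A' i := if i == w then C else if i == v then B else A i.
  have mA' i : measurable (A' i) by rewrite /A'; do 2 case: ifP => // _.
  have A's i : i \in rem v s -> A' i = A i.
    rewrite (mem_rem_uniq _ us) inE => /andP[/negbTE iv si].
    by rewrite /A' iv; case: eqP => // iw; move: ws; rewrite -iw si.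
  have := IH (w :: s) A' mA'; rewrite /= ws us => /(_ isT ues) IH'.
  transitivity (P (edge_event (w :: s) es A')); last first.
    rewrite IH'; last 2 first.
    - by move=> i /sub1'; rewrite inE => ->; rewrite orbT.
    - move=> i ies; rewrite inE negb_or sub2'// andbT.
      by apply: contraNneq wes => <-.
    rewrite big_cons (perm_big _ (perm_to_rem vs)) big_cons /=.
    rewrite {1 2}/A' !eqxx (negbTE vw) -/c.
    (* No remaining edge starts at [w], since all sources lie in [s]; its factor is therefore just
       [mu C]. *)
    rewrite (_ : count _ es = 0%N); last first.
      apply/eqP; rewrite -leqn0 leqNgt -has_count; apply/hasPn => e ees.
      by apply: contraNneq ws => <-; apply: sub1'; exact: map_f.
    under eq_integral do rewrite expr0.
    rewrite integral_cst// mul1e muleC; congr (_ * _).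
    rewrite muleC; congr (_ * _); apply: eq_big_seq => i /A's ->//.
  congr (P _); apply/seteqP; split => t.
    move=> [[h1 h2] [h3 h4]]; split=> // i; rewrite inE => /predU1P[->|si].
      by rewrite /A' eqxx.
    have [->|iv] := eqVneq i v; first by rewrite /A' eqxx (negbTE vw).
    have ir : i \in rem v s by rewrite (mem_rem_uniq _ us) inE iv.
    by rewrite A's//; exact: h1.
  move=> [h1 h2]; split; split=> //.
  - move=> i ir; rewrite -A's//; apply: h1; rewrite inE; apply/orP; right.
    exact: mem_rem ir.
  - have := h1 v; rewrite inE vs orbT /A' eqxx (negbTE vw); exact.
  - have := h1 w; rewrite inE eqxx /A' eqxx; exact.
have HE1 B : measurable B -> P (H `&` X v @^-1` B) =
    K * \int[mu]_(x in B) (section_prob mu D x ^+ c)%:E.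
  move=> mB; have := HE B setT mB measurableT.
  by rewrite preimage_setT setIT probability_setT mule1.
pose D1 := D `&` (A v `*` setT).
have mD1 : measurable D1 by apply: measurableI => //; exact: measurableX.
transitivity (P (H `&` [set t | D1 (X v t, X w t)])).
  congr (P _); apply/seteqP; split => t.
    move=> [h1 h2]; split.
      split=> [i ir|e ees]; first by apply: h1; exact: mem_rem ir.
      by apply: h2; rewrite inE ees orbT.
    split; first by apply: (h2 (v, w)); rewrite inE eqxx.
    by split=> //; exact: h1.
  move=> [[h1 h2] [h3 [h4 _]]]; split=> [i si|e].
    have [->//|iv] := eqVneq i v.
    by apply: h1; rewrite (mem_rem_uniq _ us) inE iv.
  by rewrite inE => /predU1P[->//|]; exact: h2.
rewrite (@independent_section _ _ _ _ _ _ mu)//; last first.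
  by move=> B C mB mC; rewrite HE// HE1.
transitivity (\int[mu]_y (K *
    \int[mu]_(x in A v `&` ysection D y) (section_prob mu D x ^+ c)%:E)).
  apply: eq_integral => y _; rewrite HE1; last exact: measurable_ysection.
  congr (_ * integral _ _ _); apply/seteqP; split => x; rewrite /ysection /= !inE.
    by move=> [? []].
  by move=> [].
rewrite integral_ysection_moment// (perm_big _ (perm_to_rem vs)) big_cons muleC.
rewrite eqxx add1n; congr (_ * _).
apply: eq_big_seq => i; rewrite (mem_rem_uniq _ us) inE => /andP[iv _].
by rewrite eq_sym (negbTE iv).
Qed.

End EdgeIndependence.
End SectionProbability.

(** * Path probabilities in terms of child counts *)

Section PathProbability.
Context {R : realType} {d : measure_display} {T : measurableType d}.
Variables (P : probability T R) (G : rooted_tree) (X : G -> {RV P >-> R}).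
Variable (mu : probability R R).
Hypothesis hG : has_height G 2.
Hypothesis indepX : mutually_independent X.
Hypothesis lawX : forall v A, measurable A -> P (X v @^-1` A) = mu A.
Local Open Scope ring_scope.
Local Open Scope ereal_scope.

Lemma measurable_pair_tuple : measurable_fun setT (fun z : R * R => [tuple z.1; z.2]).
Proof.
apply: (measurable_cons measurable_fst).
exact: (measurable_cons measurable_snd (measurable_cst _)).
Qed.

Lemma measurable_singleton_tuple : measurable_fun setT (fun x : R => [tuple x]).
Proof. exact: (@measurable_cons _ _ R R id 0%N (fun=> [tuple])). Qed.

Lemma path_event_gt2 n (B : set (n.-tuple R)) : (2 < n)%N -> path_event X B = set0.
Proof.
move=> n2; apply/seteqP; split=> t //= -[p [op up _]].
by have := simple_path_le2 hG op up; rewrite size_tuple leqNgt n2.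
Qed.

Lemma path_event1 (B : set (1.-tuple R)) :
  path_event X B = ~` edge_event X set0 (fset_set (generation G 1)) [::]
                       (fun=> [set x | ~ B [tuple x]]).
Proof.
apply/seteqP; split=> t /=.
  move=> [p [+ _ +]] [h _]; case/tupleP: p => v p; rewrite (tuple0 p) /= andbT.
  move=> ov; rewrite (_ : [tuple of _] = [tuple X v t]); last exact: val_inj.
  by apply: h; rewrite mem_generation1.
move=> h; apply: contrapT => nB; apply: h; split=> // v; rewrite mem_generation1 => ov Bv.
apply: nB; exists [tuple v]; split; first by rewrite /= ov.
  by rewrite /= inE (adj_neq ov).
by rewrite (_ : [tuple of _] = [tuple X v t])//; exact: val_inj.
Qed.

(** In height two, the self-avoiding paths of length 2 from the root correspond exactly to
    [child_edges]. *)
Lemma path_event2 (B : set (2.-tuple R)) :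
  path_event X B = ~` edge_event X [set z | ~ B [tuple z.1; z.2]]
    (fset_set (generation G 1)) (child_edges G) (fun=> setT).
Proof.
apply/seteqP; split=> t /=.
  move=> [p [+ + +]] [_ h]; case/tupleP: p => v p; case/tupleP: p => w p.
  rewrite (tuple0 p) /= andbT => /andP[ov vw].
  rewrite !inE negb_or => /and3P[/andP[_ ow] _ _].
  rewrite (_ : [tuple of _] = [tuple X v t; X w t]); last exact: val_inj.
  by apply: (h (v, w)); rewrite mem_child_edges2// ov vw eq_sym.
move=> h; apply: contrapT => nB; apply: h; split=> // -[v w] /=.
rewrite mem_child_edges2// => /and3P[ov vw ow] Bvw.
apply: nB; exists [tuple v; w]; split; first by rewrite /= ov vw.
  by rewrite /= !inE negb_or (adj_neq ov) (adj_neq vw) eq_sym ow.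
by rewrite (_ : [tuple of _] = [tuple X v t; X w t])//; exact: val_inj.
Qed.

(** The exponent is the size of the first generation: [child_counts] also records the zeros of
    childless vertices. *)
Lemma path_prob1 (B : set (1.-tuple R)) : measurable B ->
  path_prob X B =
  (1 - fine (mu [set x | ~ B [tuple x]]) ^+ size (child_counts G))%:E.
Proof.
move=> mB; have mC : measurable [set x : R | ~ B [tuple x]].
  apply: measurableC; exact: measurable_preimageT measurable_singleton_tuple mB.
rewrite /path_prob path_event1 probability_setC; last exact: measurable_edge_event.
rewrite (@probability_edge_event _ _ _ _ _ _ mu)//.
have muC : mu [set x | ~ B [tuple x]] \is a fin_num by exact: fin_num_measure.
rewrite (eq_bigr (fun=> (fine (mu [set x | ~ B [tuple x]]))%:E)); last first.
  move=> v _; under eq_integral do rewrite expr0.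
  by rewrite integral_cst// mul1e fineK.
rewrite prodEFin big_const_seq iter_mulr_1 count_predT.
by rewrite /child_counts size_sort size_map EFinB.
Qed.

(** Given its own label, a vertex with [c] children avoids B with probability [g ^+ c]; averaging
    gives the moment of order [c], and distinct vertices are independent. *)
Lemma path_prob2 (B : set (2.-tuple R)) : measurable B ->
  path_prob X B =
  (1 - \prod_(c <- child_counts G)
     section_moment mu [set z | ~ B [tuple z.1; z.2]] c)%:E.
Proof.
move=> mB; have mD : measurable [set z : R * R | ~ B [tuple z.1; z.2]].
  apply: measurableC; exact: measurable_preimageT measurable_pair_tuple mB.
rewrite /path_prob path_event2 probability_setC; last exact: measurable_edge_event.
rewrite (@probability_edge_event _ _ _ _ _ _ mu)//; last 3 first.
- exact: uniq_child_edges.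
- move=> v /mapP[[v' w]]; rewrite mem_child_edges2// => /and3P[ov _ _ ->].
  by rewrite mem_generation1.
- move=> w /mapP[[v w']]; rewrite mem_child_edges => /and3P[_ _ /eqP w2] ->.
  by rewrite mem_generation1; apply/negP => /depth1; rewrite w2.
rewrite EFinB; congr (_ - _); rewrite /child_counts.
rewrite (perm_big _ (permEl (perm_sort _ _))) big_map -prodEFin.
apply: eq_big_seq => v; rewrite mem_generation1 => ov.
by rewrite count_child_edges// section_momentE.
Qed.

End PathProbability.

(** * Existence of i.i.d. labels *)

Section IidExistence.
Context {R : realType}.
Local Open Scope ring_scope.
Local Open Scope ereal_scope.

Lemma measurable_id_measurableTypeR :
  measurable_fun (T := measurableTypeR R) (U := R) setT idfun.
Proof. by move=> _ U mU; rewrite setTI. Qed.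

(** The uniform law lives on [measurableTypeR R]; its image under the identity transports it to
    [R]. *)
Lemma exists_uniform_law : exists mu : probability R R,
  forall p : R, (0 <= p <= 1)%R -> mu [set x | (x < p)%R] = p%:E.
Proof.
exists (@distribution _ _ (measurableTypeR R) R R (uniform_prob (@ltr01 R))
  (@mfun_Sub _ _ (measurableTypeR R) R _ (mem_set measurable_id_measurableTypeR))).
move=> p /andP[p0 p1]; have pE : [set x : R | (x < p)%R] = [set` `]-oo, p[%R].
  by apply/seteqP; split=> x /=; rewrite in_itv.
rewrite /distribution /pushforward /= preimage_id pE.
have mp : measurable (`]-oo, p[%classic : set (measurableTypeR R)).
  exact: measurable_itv.
transitivity (\int[uniform_prob (@ltr01 R)]_x (\1_(`]-oo, p[%classic) x)%:E).
  by rewrite integral_indic ?setIT.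
rewrite integral_uniform//; last exact/measurable_EFinP/measurable_indic.
rewrite subr0 invr1 mul1e integral_indic//.
rewrite (_ : _ `&` _ = `[0%R, p[%classic); last first.
  apply/seteqP; split=> x /=; rewrite !in_itv /=; first by move=> [-> /andP[->]].
  by move=> /andP[-> xp]; rewrite xp (ltW (lt_le_trans xp p1)).
rewrite [LHS]lebesgue_measure_itv /= lte_fin.
by case: ltgtP p0 => // [_|<-] _; rewrite ?sube0.
Qed.

Definition mk_rv d (T : measurableType d) (P : probability T R) (f : T -> R)
  (mf : measurable_fun setT f) : {RV P >-> R} := mfun_Sub (mem_set mf).

(** A finite product space built one coordinate at a time: a new index [i] takes a fresh coordinate
    of law [mu], and the other variables factor through the old space. Variables outside [s] already
    have law [mu], but their independence is not claimed. *)
Lemma exists_iid_on (mu : probability R R) (I : choiceType) (s : seq I) :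
  exists (d : measure_display) (T : measurableType d) (P : probability T R)
      (X : I -> {RV P >-> R}),
    (forall i A, measurable A -> P (X i @^-1` A) = mu A) /\
    (forall (F : {fset I}) (A : I -> set R), (forall i, measurable (A i)) ->
      {subset F <= s} ->
      P (\bigcap_(i in [set` F]) X i @^-1` A i) =
      \prod_(i <- F) P (X i @^-1` A i)).
Proof.
elim: s => [|i s [d [T [P [X [lawX indX]]]]]].
  exists _, R, mu, (fun=> mk_rv mu (@measurable_id _ R setT)); split=> // F A mA Fs.
  have -> : F = fset0 by apply/fsetP => i; apply/negP => /Fs.
  by rewrite big_seq_fset0 set_fset0 bigcap_set0 probability_setT.
have [si|si] := boolP (i \in s).
  exists d, T, P, X; split=> // F A mA Fs; apply: indX => // j /Fs.
  by rewrite inE => /predU1P[->|].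
pose Q : probability (T * R)%type R := (P \x mu).
pose X' j : {RV Q >-> R} := if j == i then mk_rv Q measurable_snd
  else mk_rv Q (measurableT_comp (measurable_funPT (X j)) measurable_fst).
have XiE A : X' i @^-1` A = setT `*` A.
  by rewrite /X' eqxx /=; apply/seteqP; split=> -[x y] /=; [|case].
have XjE j A : j != i -> X' j @^-1` A = (X j @^-1` A) `*` setT.
  by move=> /negbTE ji; rewrite /X' ji /=; apply/seteqP; split=> -[x y] /=; [|case].
have mX j A : measurable A -> measurable (X j @^-1` A).
  by move=> mA; rewrite -[_ @^-1` _]setTI; exact: measurable_funPT.
have law' j A : measurable A -> Q (X' j @^-1` A) = mu A.
  move=> mA; have [->|ji] := eqVneq j i.
    rewrite XiE [LHS]product_measure1E// [X in X * _]probability_setT mul1e//.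
  rewrite XjE// [LHS]product_measure1E//; last exact: mX.
  by rewrite [X in _ * X]probability_setT mule1; exact: lawX.
exists _, _, Q, X'; split=> // F A mA Fs.
have mcap E : {in E, forall j, j != i} ->
    \bigcap_(j in [set` E]) X' j @^-1` A j =
    (\bigcap_(j in [set` E]) X j @^-1` A j) `*` setT.
  move=> Ei; apply/seteqP; split=> -[x y] /=.
    by move=> h; split=> // j jE; have := h j jE; rewrite XjE ?Ei// => -[].
  by move=> [h _] j jE; rewrite XjE ?Ei//; split=> //; exact: h.
have mcapX (E : {fset I}) : measurable (\bigcap_(j in [set` E]) X j @^-1` A j).
  rewrite bigcap_fset; apply: bigsetI_measurable => j _; exact: mX.
have FDi j : j \in (F `\ i)%fset -> j != i by rewrite !inE => /andP[].
have indD : P (\bigcap_(j in [set` (F `\ i)%fset]) X j @^-1` A j) =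
    \prod_(j <- (F `\ i)%fset) Q (X' j @^-1` A j).
  rewrite indX//; last first.
    by move=> j; rewrite !inE => /andP[/negbTE ji /Fs]; rewrite inE ji.
  by apply: eq_bigr => j _; rewrite law'// lawX.
have [iF|iF] := boolP (i \in F); last first.
  rewrite -[F](@mem_fsetD1 _ i)// mcap// [LHS]product_measure1E//.
  by rewrite [X in _ * X]probability_setT mule1.
rewrite (big_fsetD1 i)//= -indD law'// -[in LHS](fsetD1K iF).
(* Separating [i] from the other indices exhibits the event as a rectangle in the product space. *)
rewrite (_ : \bigcap_(j in _) _ =
    (\bigcap_(j in [set` (F `\ i)%fset]) X j @^-1` A j) `*` A i); last first.
  apply/seteqP; split=> -[x y] /=.
    move=> h; split=> [j jF|].
      have := h j; rewrite XjE ?FDi// => h'.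
      have []// := h' _; rewrite /= !inE; apply/orP; right.
      by move: jF; rewrite /= !inE.
    have := h i; rewrite XiE => h'; have []// := h' _.
    by rewrite /= !inE eqxx.
  move=> [h1 h2] j /=; rewrite !inE => /predU1P[->|jF].
    by rewrite -[A i _]/((X' i @^-1` A i) (x, y)) XiE.
  rewrite -[A j _]/((X' j @^-1` A j) (x, y)) XjE ?FDi ?inE//.
  by split=> //; apply: h1; rewrite /= !inE.
by rewrite [LHS]product_measure1E// muleC.
Qed.
End IidExistence.

(** * Domination *)

Section Iid.
Context {R : realType}.

Lemma exists_iid (mu : probability R R) (I : choiceType) (s : seq I) :
    (forall i, i \in s) ->
  exists (d : measure_display) (T : measurableType d) (P : probability T R)
      (X : I -> {RV P >-> R}),
    iid X /\ forall i A, measurable A -> P (X i @^-1` A) = mu A.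
Proof.
move=> Is; have [d [T [P [X [lawX indX]]]]] := exists_iid_on mu s.
exists d, T, P, X; split=> //; split; first by move=> F A mA; exact: indX.
by move=> i j A mA; rewrite /distribution /pushforward !lawX.
Qed.

Context {d : measure_display} {T : measurableType d} {P : probability T R}.

Lemma mutually_independent_comp (I J : choiceType) (f : J -> I)
    (X : I -> {RV P >-> R}) : injective f ->
  mutually_independent X -> mutually_independent (X \o f).
Proof.
move=> finj indX F A mA.
(* The sets are carried along the injection [f], with no constraint off the image of [F]. *)
pose A' i := if [pick j : F | f (val j) == i] is Some j then A (val j) else setT.
have A'E j : j \in F -> A' (f j) = A j.
  move=> jF; rewrite /A'; case: pickP => [k /eqP/finj <-//|/(_ [` jF]%fset)].
  by rewrite eqxx.
have mA' i : measurable (A' i) by rewrite /A'; case: pickP.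
have := indX (f @` F)%fset A' mA'; rewrite big_imfset /=; last first.
  by move=> i j _ _; exact: finj.
rewrite (@eq_big_seq _ _ _ _ F _ (fun j => P ((X \o f) j @^-1` A j))); last first.
  by move=> j jF; rewrite A'E.
move=> <-; congr (P _); apply/seteqP; split=> t /= h.
  by move=> i /= /imfsetP[j /= jF ->]; rewrite A'E//; exact: h.
move=> j /= jF; rewrite -A'E//; apply: h; apply/imfsetP; by exists j.
Qed.

End Iid.

(** * Child counts padded with zeros *)

Section ChildCounts.
Variable G : rooted_tree.
Local Notation c := (child_counts G).

Lemma nth_child_counts_homo : {homo nth 0 c : i j / i <= j >-> j <= i}.
Proof.
move=> i j ij; have [jc|jc] := ltnP j (size c); last by rewrite nth_default.
apply: (sorted_leq_nth (leT := geq)) => //.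
- by move=> x y z /= xy yz; exact: leq_trans yz xy.
- by move=> x; exact: leqnn.
- by apply: sort_sorted => x y; exact: leq_total.
- by rewrite inE (leq_ltn_trans ij).
Qed.

Lemma mem_child_counts n : reflect
  (exists2 v, generation G 1 v & num_children v = n) (n \in c).
Proof.
rewrite mem_sort; apply: (iffP mapP) => -[v].
  by rewrite mem_generation1 => /depth1 v1 ->; exists v.
move=> v1 <-; exists v => //; rewrite mem_generation1.
by move: v1; rewrite generation1E.
Qed.

(** The default value 0 of [nth] supplies the appended zeros, each contributing a factor
    [a 0 = 1]. *)
Lemma prod_child_counts (R : comPzRingType) (a : nat -> R) (b : nat) :
    a 0 = 1%R -> size c <= b ->
  (\prod_(n <- c) a n = \prod_(0 <= i < b) a (nth 0 c i))%R.
Proof.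
move=> a0 cb; rewrite (@big_cat_nat _ _ _ (size c))//= -(big_nth 0 predT).
rewrite [X in (_ * X)%R]big_nat [X in (_ * X)%R]big1 ?mulr1//.
by move=> i /andP[ci _]; rewrite nth_default.
Qed.

Lemma num_children_eq0 (v : G) : num_children v = 0 -> children v = set0.
Proof.
move=> /eqP; rewrite cardfs_eq0 => /eqP v0; apply/seteqP; split=> w // [vw lt].
by have := mem_children v w; rewrite v0 vw lt.
Qed.

Hypothesis hG : has_height G 2.

Lemma exists_child_count_gt0 : exists2 n, n \in c & 0 < n.
Proof.
have [[w w2] _] := hG; have [v vw v1] := depth_parent w2.
exists (num_children v); first by apply/mem_child_counts; exists v.
have : w \in fset_set (children v) by rewrite mem_children vw v1 w2.
by rewrite /num_children lt0n cardfs_eq0; apply: contraTneq => ->; rewrite in_fset0.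
Qed.

(** Finiteness of the tree lets a finite product space carry all its labels. *)
Lemma exists_vertex_enum : exists s : seq G, forall v, v \in s.
Proof.
exists (Defs.root G :: fset_set (generation G 1) ++ unzip2 (child_edges G)) => v.
rewrite inE mem_cat; case vn : (depth v) (depth_le2 hG v) => [|[|[|//]]] _.
- by move/eqP: vn; rewrite depth_eq0 => ->.
- have : generation G 1 v by [].
  by rewrite mem_generation1 generation1E => ->; rewrite orbT.
- have [u uv u1] := depth_parent vn; apply/orP; right; apply/orP; right.
  apply/mapP; exists (u, v); rewrite // mem_child_edges uv vn.
  by have : generation G 1 u by []; rewrite generation1E => ->.
Qed.

End ChildCounts.

Section Domination.
Variables (R : realType) (G G' : rooted_tree).
Hypotheses (hG : has_height G 2) (hG' : has_height G' 2).
Local Notation c := (child_counts G).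
Local Notation c' := (child_counts G').
Local Notation b := (maxn (size c) (size c')).

(** Tail sums do not see childless vertices, but paths of length 1 do. If [c'] were longer, the tail
    at [size c] would force a zero entry in [c'], hence a leaf in the first generation of [G'], and
    the first hypothesis applies. *)
Lemma leq_size_child_counts :
    ((exists2 v : G', generation G' 1 v & children v = set0) -> size c' <= size c) ->
    (forall k, \sum_(k <= i < b) nth 0 c' i <= \sum_(k <= i < b) nth 0 c i) ->
  size c' <= size c.
Proof.
move=> hleaf tails; rewrite leqNgt; apply/negP => cc'.
have := tails (size c).
rewrite [X in _ <= X]big_nat [X in _ <= X]big1; last first.
  by move=> i /andP[ci _]; rewrite nth_default.
rewrite big_ltn; last by rewrite leq_max cc' orbT.
rewrite leqn0 addn_eq0 => /andP[/eqP c0 _].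
have /mem_child_counts[v v1 v0] : 0 \in c' by rewrite -c0 mem_nth.
by move: cc'; rewrite ltnNge hleaf//; exists v => //; exact: num_children_eq0.
Qed.

Local Open Scope ring_scope.

Lemma prod_section_moment_le (mu : probability R R) (D : set (R * R)) :
    measurable D ->
    (forall k, \sum_(k <= i < b) nth 0 c' i <= \sum_(k <= i < b) nth 0 c i)%N ->
  \prod_(n <- c) section_moment mu D n <= \prod_(n <- c') section_moment mu D n.
Proof.
move=> mD tails; set a := section_moment mu D.
have a_ge0 n : 0 <= a n by exact: section_moment_ge0.
have aS n : a n.+1 <= a n by exact: section_momentS_le.
have acvx n : a n.+1 ^+ 2 <= a n * a n.+2 by exact: section_moment_log_convex.
(* Logarithms need positive moments. If [a 1] vanishes, so do all later moments, and a positive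
   entry of [c] makes the left product zero. *)
have [a1|a1] := eqVneq (a 1%N) 0.
  have a0 n : (0 < n)%N -> a n = 0.
    case: n => // n _; elim: n => [|n IH]; first exact: a1.
    by apply/eqP; rewrite eq_le a_ge0 andbT -IH aS.
  have [n nc n0] := exists_child_count_gt0 hG.
  by rewrite (perm_big _ (perm_to_rem nc)) big_cons /= (a0 n)// mul0r prodr_ge0.
have a_gt0 n : 0 < a n.
  rewrite lt_def a_ge0 andbT; case: n => [|n].
    by apply: contra_neq a1 => a0; apply/eqP; rewrite eq_le a_ge0 andbT -a0 aS.
  (* By log-convexity, a vanishing moment of order [n.+2] forces the one of order [n.+1] to
     vanish. *)
  elim: n => // n; apply: contra_neq => a0; have := acvx n.
  by rewrite a0 mulr0 le_eqVlt ltNge sqr_ge0 orbF expf_eq0 /= => /eqP.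
have a0 : a 0%N = 1 by exact: section_moment0.
rewrite !(@prod_child_counts _ _ a b) ?leq_maxl ?leq_maxr//.
apply: prod_log_convex_le => // i.
exact: nth_child_counts_homo.
Qed.

Lemma dominates_of_tails : (size c' <= size c)%N ->
    (forall k, \sum_(k <= i < b) nth 0 c' i <= \sum_(k <= i < b) nth 0 c i)%N ->
  dominates R G G'.
Proof.
move=> cc' tails d T P X X' [indXX' lawXX'] n B n0 mB.
(* The labels of both trees form one i.i.d. family, so the law at the root of [G] serves for all of
   them. *)
pose mu : probability R R := distribution P (X (Defs.root G)).
have indX : mutually_independent X.
  by apply: (mutually_independent_comp (f := inl) _ indXX') => v w [].
have indX' : mutually_independent X'.
  by apply: (mutually_independent_comp (f := inr) _ indXX') => v w [].
have lawX v A : measurable A -> P (X v @^-1` A) = mu A.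
  by move=> mA; exact: (lawXX' (inl v) (inl (Defs.root G))).
have lawX' v A : measurable A -> P (X' v @^-1` A) = mu A.
  by move=> mA; exact: (lawXX' (inr v) (inl (Defs.root G))).
have [n2|n2] := ltnP 2 n.
  by rewrite /path_prob (path_event_gt2 _ hG')// measure0.
move: n n0 n2 B mB => [|[|[|//]]]// _ _ B mB.
- rewrite (path_prob1 indX lawX mB) (path_prob1 indX' lawX' mB).
  rewrite lee_fin lerB// ler_wiXn2l ?fine_ge0//.
  have mC : measurable [set x : R | ~ B [tuple x]].
    by apply: measurableC; exact: measurable_preimageT measurable_singleton_tuple mB.
  by rewrite -lee_fin fineK ?fin_num_measure// probability_le1.
- rewrite (path_prob2 hG indX lawX mB) (path_prob2 hG' indX' lawX' mB).
  rewrite lee_fin lerB// prod_section_moment_le//.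
  by apply: measurableC; exact: measurable_preimageT measurable_pair_tuple mB.
Qed.

(** The middle term is [q ^+ n + q ^+ m - q ^+ (n + m)], which lies between the larger of the two
    powers and their sum. *)
Lemma two_valued_moment_bounds (q : R) (m n : nat) : 0 <= q <= 1 ->
  q ^+ minn n m <= q ^+ n + (1 - q ^+ n) * q ^+ m <= 2 * q ^+ minn n m.
Proof.
move=> /andP[q0 q1].
have n0 : 0 <= q ^+ n by rewrite exprn_ge0.
have n1 : q ^+ n <= 1 by rewrite exprn_ile1.
have m0 : 0 <= q ^+ m by rewrite exprn_ge0.
have m1 : q ^+ m <= 1 by rewrite exprn_ile1.
case: (leqP n m) => [nm|/ltnW mn].
  have : q ^+ m <= q ^+ n by rewrite ler_wiXn2l.
  by move=> ?; apply/andP; split; nra.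
have : q ^+ n <= q ^+ m by rewrite ler_wiXn2l.
by move=> ?; apply/andP; split; nra.
Qed.

Lemma tails_of_dominates : dominates R G G' ->
  forall k, (\sum_(k <= i < b) nth 0 c' i <= \sum_(k <= i < b) nth 0 c i)%N.
Proof.
move=> dom; apply: leq_tail_sum; first exact: nth_child_counts_homo.
(* The constant [2 ^ b] collects one factor 2 from the upper bound on each of the [b] moments for
   [G']. *)
move=> m m0; apply: (@leq_exponent_of_bounded R (2 ^ b)) => M M0.
set q := M%:R^-1; pose p := q ^+ m.
have q0 : 0 <= q by rewrite invr_ge0.
have q1 : q <= 1 by rewrite invf_le1 ?ltr0n// ler1n.
have q01 : 0 <= q <= 1 by rewrite q0.
have p01 : 0 <= p <= 1 by rewrite exprn_ge0//= exprn_ile1.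
have [mu mulaw] := @exists_uniform_law R.
have [s sG] := exists_vertex_enum hG; have [s' sG'] := exists_vertex_enum hG'.
have enumGG' (i : G + G') : i \in [seq inl v | v <- s] ++ [seq inr v | v <- s'].
  by case: i => v; rewrite mem_cat map_f ?orbT.
have [d [T [P [Z [iidZ lawZ]]]]] := exists_iid mu enumGG'.
(* The complement of [B] has full section over [x < p] and section [y < q] over the other [x]; under
   the uniform law these have mass 1 and [q]. *)
pose B : set (2.-tuple R) := [set t | p <= tnth t ord0 /\ q <= tnth t ord_max].
have mB : measurable B.
  rewrite (_ : B = (fun t => tnth t ord0) @^-1` `[p, +oo[ `&`
                   (fun t => tnth t ord_max) @^-1` `[q, +oo[).
    apply: measurableI.
      by apply: measurable_preimageT; [exact: measurable_tnth|exact: measurable_itv].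
    by apply: measurable_preimageT; [exact: measurable_tnth|exact: measurable_itv].
  by apply/seteqP; split=> t; rewrite /B /= !in_itv /= !andbT.
set D := [set z : R * R | ~ B [tuple z.1; z.2]].
have mD : measurable D.
  by apply: measurableC; exact: measurable_preimageT measurable_pair_tuple mB.
have ZE : (fun i => match i with inl v => (Z \o inl) v | inr w => (Z \o inr) w end) = Z.
  by apply/funext => -[].
have := dom d T P (Z \o inl) (Z \o inr); rewrite ZE => /(_ iidZ 2%N B isT mB).
have indl := mutually_independent_comp (f := inl) (@inl_inj _ _) iidZ.1.
have indr := mutually_independent_comp (f := inr) (@inr_inj _ _) iidZ.1.
rewrite (path_prob2 hG indl (fun v => lawZ (inl v)) mB).
rewrite (path_prob2 hG' indr (fun v => lawZ (inr v)) mB).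
rewrite lee_fin lerBrDr -lerBrDl opprB addrCA subrr addr0 -/D.
set a := section_moment mu D => le_prod.
have aE n : a n = q ^+ n + (1 - q ^+ n) * p.
  apply: (@section_moment_two_valued _ _ _ mD [set x | x < p]) => //.
  - by rewrite -[[set _ | _]]/([set` `]-oo, p[]); exact: measurable_itv.
  - exact: mulaw.
  - move=> x xp; apply: EFin_inj; rewrite section_probE// -(probability_setT mu).
    congr (mu _); apply/seteqP; split=> y // _.
    by rewrite /xsection /= inE => -[]; rewrite leNgt xp.
  - move=> x /negP; rewrite -leNgt => px; apply: EFin_inj.
    rewrite section_probE// -mulaw//; congr (mu _).
    apply/seteqP; split=> y; rewrite /xsection /= inE => yq.
      by rewrite ltNge; apply/negP => qy; apply: yq.
    by move=> [_]; rewrite leNgt yq.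
have a0 : a 0%N = 1 by exact: section_moment0.
have bounds n := two_valued_moment_bounds m n q01.
move: le_prod; rewrite !(@prod_child_counts _ _ a b) ?leq_maxl ?leq_maxr// => le_prod.
have q_ge0 n : 0 <= q ^+ n by rewrite exprn_ge0.
rewrite natrX !expr_sum.
(* Lower bounds on the moments for [G], then domination, then upper bounds on the moments for
   [G']. *)
apply: (@le_trans _ _ (\prod_(0 <= i < b) a (nth 0%N c i))).
  by apply: ler_prod => i _; rewrite q_ge0 aE; have /andP[] := bounds (nth 0%N c i).
apply: (le_trans le_prod).
rewrite -[X in 2%:R ^+ X]subn0 -prodr_const_nat -big_split /=.
apply: ler_prod => i _; rewrite section_moment_ge0// aE.
by have /andP[] := bounds (nth 0%N c' i).
Qed.

End Domination.

Theorem proposition6 (R : realType) (G G' : rooted_tree)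
    (hG : has_height G 2) (hG' : has_height G' 2)
    (hleaf : (exists2 v : G', generation G' 1 v & children v = set0) ->
             size (child_counts G') <= size (child_counts G)) :
  let b := maxn (size (child_counts G)) (size (child_counts G')) in
  dominates R G G' <->
  forall k : nat,
    \sum_(k <= i < b) nth 0 (child_counts G') i
      <= \sum_(k <= i < b) nth 0 (child_counts G) i.
Proof.
move=> b; split=> [|tails]; first exact: tails_of_dominates.
by apply: dominates_of_tails => //; exact: leq_size_child_counts hleaf tails.
Qed.
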